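(* Let $(\Omega,\mu,(\Pi_0,\Pi_1))$ be a finite information structure, $C\subseteq\Omega$ an event, $i\in\{0,1\}$ a player and $\omega\in\Omega$ a state. Then the value returned by $\text{common\_p\_belief}(C,i,\omega)$ is the $C$-evidence level of $E$, where $E$ is the maximally evident $C$-indicating event of highest $C$-evidence level among those containing some element of $\Pi_i(\omega)$.
   Context: An information structure $(\Omega,\mu,(\Pi_0,\Pi_1))$ consists of a finite set $\Omega$ of states, a probability measure $\mu$ on $\Omega$, and two partitions $\Pi_0,\Pi_1$ of $\Omega$ (one per player $i\in\{0,1\}$). $\Pi_i(\omega)$ is the cell of $\Pi_i$ containing $\omega$; every cell is assumed to have positive $\mu$-measure. Events are subsets of $\Omega$. Put $P_i(E\mid\omega)=\mu(E\cap\Pi_i(\omega))/\mu(\Pi_i(\omega))$. All $p$ range over $[0,1]$. Given an event $C$: $E$ is a $p$-evident $C$-indicating event if for all $\omega\in E$ and all players $i$, $P_i(E\mid\omega)\ge p$ and $P_i(C\mid\omega)\ge p$. $E$ is the largest $p$-evident $C$-indicating event if $E$ is a $p$-evident $C$-indicating event and every $p$-evident $C$-indicating event is a subset of $E$. The $C$-evidence level of $E$ is the maximum $p\in[0,1]$ for which $E$ is a $p$-evident $C$-indicating event. $E$ is the maximally evident $C$-indicating superset of $F$ if $F\subseteq E$ and, with $p$ the $C$-evidence level of $E$, $E$ is the largest $p$-evident $C$-indicating event and every event $G\supseteq F$ has $C$-evidence level at most $p$. A maximally evident $C$-indicating event is an event that is the maximally evident $C$-indicating superset of some $F\subseteq\Omega$.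 Algorithms. - $\text{min\_belief}(E,C,\omega)=\min_{i\in\{0,1\}}\min(P_i(E\mid\omega),P_i(C\mid\omega))$. - $\text{evidence\_level}(E,C)=\min_{\omega\in E}\text{min\_belief}(E,C,\omega)$ (called below only on nonempty $E$). - $\text{super\_p\_evident}(E,C,p)$: as long as there exists $\omega\in E$ with $\text{min\_belief}(E,C,\omega)\le p$ (for the current $E$), choose such an $\omega$ and replace $E$ by $E\setminus\{\omega\}$; when no such $\omega$ exists, return $E$. - $\text{common\_p\_belief}(C,i,\omega)$: set $E:=\Omega$, $F:=\Omega$. While $P_i(F\mid\omega)>0$: set $p:=\text{evidence\_level}(F,C)$, then $E:=F$, then $F:=\text{super\_p\_evident}(E,C,p)$. After the loop return $\text{evidence\_level}(E,C)$. *)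

(* Defs.v *)
From mathcomp Require Import all_boot all_order all_algebra.
From mathcomp Require Import reals.
Set Implicit Arguments.
Unset Strict Implicit.
Unset Printing Implicit Defensive.
Import Order.TTheory GRing.Theory Num.Theory.
Local Open Scope ring_scope.

(* Every subset of the finite set Omega is an event, so finite additivity is all
   that the axioms of a probability measure require. *)
Record info_structure (R : realType) (Omega : finType) := InfoStructure {
  mu : {set Omega} -> R;
  Pi : 'I_2 -> {set {set Omega}};
  mu_ge0 : forall A, 0 <= mu A;
  mu_setT : mu [set: Omega] = 1;
  mu_additive : forall A B : {set Omega}, [disjoint A & B] -> mu (A :|: B) = mu A + mu B;
  Pi_partition : forall i, partition (Pi i) [set: Omega];
  Pi_positive : forall i B, B \in Pi i -> 0 < mu B
}.

Section Evidence.
Variables (R : realType) (Omega : finType) (S : info_structure R Omega).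
Implicit Types (C E F G : {set Omega}) (i : 'I_2) (w : Omega) (p q v : R).

Definition cell i w : {set Omega} := pblock (Pi S i) w.

(* P_i(E | w) *)
Definition belief i E w : R := mu S (E :&: cell i w) / mu S (cell i w).

Definition p_evident_indicating C p E : Prop :=
  forall w i, w \in E -> p <= belief i E w /\ p <= belief i C w.

Definition largest_p_evident_indicating C p E : Prop :=
  p_evident_indicating C p E /\ forall G, p_evident_indicating C p G -> G \subset E.

(* p is the C-evidence level of E: the maximum of the p in [0, 1] for which E is
   p-evident C-indicating. The empty event has level 1. *)
Definition is_evidence_level C E p : Prop :=
  [/\ 0 <= p <= 1, p_evident_indicating C p E
    & forall q, 0 <= q <= 1 -> p_evident_indicating C q E -> q <= p].

Definition max_evident_superset C F E : Prop :=
  F \subset E /\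
  exists p, [/\ is_evidence_level C E p, largest_p_evident_indicating C p E
    & forall G q, F \subset G -> is_evidence_level C G q -> q <= p].

Definition max_evident C E : Prop := exists F, max_evident_superset C F E.

Definition max_evident_meeting C i w E : Prop :=
  max_evident C E /\ exists2 w', w' \in E & w' \in cell i w.

Definition highest_max_evident_meeting C i w E : Prop :=
  max_evident_meeting C i w E /\
  forall G p q, max_evident_meeting C i w G ->
    is_evidence_level C E p -> is_evidence_level C G q -> q <= p.

(* Beliefs are at most 1, so the neutral element 1 of the iterated minima below
   does not affect a minimum over a nonempty index set. *)
Definition min_belief E C w : R :=
  \big[Num.min/1]_(i < 2) Num.min (belief i E w) (belief i C w).

Definition evidence_level E C : R := \big[Num.min/1]_(w in E) min_belief E C w.

(* One iteration of super_p_evident; the removed state is any eligible one. *)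
Definition super_p_evident_step C p E E' : Prop :=
  exists w, [/\ w \in E, min_belief E C w <= p & E' = E :\ w].

(* Execution states of common_p_belief:
   - AtTest E F: about to test the loop condition, with program variables E, F;
   - InSuper E p F: inside the call super_p_evident(E, C, p), where F is the
     current value of the set that the call shrinks;
   - Returned v: finished with value v. *)
Inductive state : Type :=
| AtTest of {set Omega} & {set Omega}
| InSuper of {set Omega} & R & {set Omega}
| Returned of R.

Inductive step C i w : state -> state -> Prop :=
| step_enter E F : 0 < belief i F w ->
    step C i w (AtTest E F) (InSuper F (evidence_level F C) F)
| step_exit E F : ~ 0 < belief i F w ->
    step C i w (AtTest E F) (Returned (evidence_level E C))
| step_remove E p F F' : super_p_evident_step C p F F' ->
    step C i w (InSuper E p F) (InSuper E p F')
| step_super_return E p F : (forall F', ~ super_p_evident_step C p F F') ->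
    step C i w (InSuper E p F) (AtTest E F).

(* Whatever choices are made, execution from s terminates and returns v. *)
Inductive always_returns C i w v : state -> Prop :=
| always_returns_now : always_returns C i w v (Returned v)
| always_returns_later s : (exists s', step C i w s s') ->
    (forall s', step C i w s s' -> always_returns C i w v s') ->
    always_returns C i w v s.

Definition common_p_belief_returns C i w v : Prop :=
  always_returns C i w v (AtTest [set: Omega] [set: Omega]).

End Evidence.

(* Main.v *)
(* For every level p there is a largest event in which all minimal beliefs
   exceed p, because beliefs grow with the event and so such events are closed
   under union. Whatever states it removes, super_p_evident returns this event.
   Hence the loop runs through a strictly decreasing chain of events, each of
   them the largest one at its own evidence level, and any event of level above
   that of one member lies inside the next. The last member that meets the cell
   of w is therefore the sought event. *)
Require Import Defs.
From mathcomp Require Import all_boot all_order all_algebra.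
From mathcomp Require Import reals.
Set Implicit Arguments.
Unset Strict Implicit.
Unset Printing Implicit Defensive.
Import Order.TTheory GRing.Theory Num.Theory.
Local Open Scope ring_scope.

Section CommonBelief.
Variables (R : realType) (Omega : finType) (S : info_structure R Omega).
Implicit Types (C E F G : {set Omega}) (i : 'I_2) (w : Omega) (p q : R).

(** * Measure, cells and beliefs *)

Lemma mu_set0 : mu S set0 = 0.
Proof.
have d0 : [disjoint (set0 : {set Omega}) & (set0 : {set Omega})].
  by rewrite disjoints_subset sub0set.
have := mu_additive S d0; rewrite setU0 => /eqP.
by rewrite -[X in X == _]addr0 (inj_eq (addrI _)) => /eqP.
Qed.

Lemma mu_subset E F : E \subset F -> mu S E <= mu S F.
Proof.
move=> /setIidPr EF; rewrite -(setID F E) EF.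
rewrite mu_additive ?lerDl ?mu_ge0 //.
by rewrite disjoints_subset setCD subsetUr.
Qed.

Lemma mem_cell i w : w \in cell S i w.
Proof. by rewrite mem_pblock (cover_partition (Pi_partition S i)) inE. Qed.

Lemma mu_cell_gt0 i w : 0 < mu S (cell S i w).
Proof.
by apply/(@Pi_positive _ _ S i)/pblock_mem; rewrite -mem_pblock mem_cell.
Qed.

Lemma eq_cell i w w' : w' \in cell S i w -> cell S i w' = cell S i w.
Proof.
by case/and3P: (Pi_partition S i) => _ tI _ /(same_pblock tI).
Qed.

Lemma belief_ge0 i E w : 0 <= belief S i E w.
Proof. by rewrite divr_ge0 ?mu_ge0. Qed.

Lemma belief_subset i E F w : E \subset F -> belief S i E w <= belief S i F w.
Proof.
by move=> EF; rewrite ler_pM2r ?invr_gt0 ?mu_cell_gt0 // mu_subset ?setSI.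
Qed.

Lemma belief_setT i w : 0 < belief S i setT w.
Proof. by rewrite /belief setTI divr_gt0 ?mu_cell_gt0. Qed.

Lemma belief_cell i E w w' :
  w' \in cell S i w -> belief S i E w' = belief S i E w.
Proof. by move=> /eq_cell; rewrite /belief => ->. Qed.

Lemma belief_gt0_meets i E w :
  0 < belief S i E w -> exists2 w', w' \in E & w' \in cell S i w.
Proof.
have [EC0|[w' /setIP[w'E w'C]]] := set_0Vmem (E :&: cell S i w); last by exists w'.
by rewrite /belief EC0 mu_set0 mul0r ltxx.
Qed.

(** * Minimal beliefs and evidence levels *)

Lemma le_min_beliefP C p E w : p <= 1 ->
  reflect (forall i, p <= belief S i E w /\ p <= belief S i C w)
          (p <= min_belief S E C w).
Proof.
move=> p1; apply: (iffP idP) => [pm i|pb].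
  apply/andP; rewrite -le_min; apply: le_trans pm _.
  exact: bigmin_le_cond.
by apply: le_bigmin => // i _; rewrite le_min; apply/andP.
Qed.

Lemma min_belief_le1 E C w : min_belief S E C w <= 1.
Proof. exact: bigmin_le_id. Qed.

Lemma min_belief_le E C i w : min_belief S E C w <= belief S i E w.
Proof.
by have /le_min_beliefP/(_ i)[] := lexx (min_belief S E C w);
  rewrite ?min_belief_le1.
Qed.

Lemma min_belief_subset E F C w :
  E \subset F -> min_belief S E C w <= min_belief S F C w.
Proof.
move=> EF; apply/le_min_beliefP => [|i]; first exact: min_belief_le1.
have /le_min_beliefP/(_ i)[] := lexx (min_belief S E C w).
  exact: min_belief_le1.
by move=> le1 le2; split=> //; apply: le_trans le1 (belief_subset _ _ EF).
Qed.

(** The empty event is evident at every [p] while its level is 1, hence the bound on [p]. *)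
Lemma le_evidence_levelP C p E : p <= 1 ->
  p_evident_indicating S C p E <-> p <= evidence_level S E C.
Proof.
move=> p1; split=> [pE|pE w i wE].
  by apply: le_bigmin => // w wE; apply/le_min_beliefP => // i; apply: pE.
apply/(le_min_beliefP C E w p1); apply: le_trans pE _.
exact: bigmin_le_cond.
Qed.

Lemma evidence_level_le1 E C : evidence_level S E C <= 1.
Proof. exact: bigmin_le_id. Qed.

Lemma evidence_level_ge0 E C : 0 <= evidence_level S E C.
Proof. by apply/le_evidence_levelP => // w i _; rewrite !belief_ge0. Qed.

Lemma evidence_levelP C E : is_evidence_level S C E (evidence_level S E C).
Proof.
split; first by rewrite evidence_level_ge0 evidence_level_le1.
- by apply/le_evidence_levelP; rewrite ?evidence_level_le1.
- by move=> q /andP[_ q1] /le_evidence_levelP -> .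
Qed.

Lemma is_evidence_levelE C E p :
  is_evidence_level S C E p -> p = evidence_level S E C.
Proof.
case: (evidence_levelP C E) => l01 lE lmax [p01 pE pmax].
by apply/le_anti; rewrite lmax // pmax.
Qed.

Lemma evidence_level_attained E C w : w \in E ->
  exists2 x, x \in E & min_belief S E C x = evidence_level S E C.
Proof.
move=> wE; case: (arg_minP (min_belief S E C) wE) => x xE xmin.
exists x => //; apply/le_anti/andP; split; last exact: bigmin_le_cond.
by apply: le_bigmin; rewrite ?min_belief_le1.
Qed.

(** * Largest events with minimal beliefs above a bound *)

Definition strictly_evident C p E := [forall x in E, p < min_belief S E C x].

Definition strict_core C p := \bigcup_(G | strictly_evident C p G) G.

Lemma strict_core_sup C p G : strictly_evident C p G -> G \subset strict_core C p.
Proof. by move=> pG; apply: bigcup_sup. Qed.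

Lemma strict_coreP C p : strictly_evident C p (strict_core C p).
Proof.
apply/forall_inP => x /bigcupP[G pG xG].
exact: lt_le_trans (forall_inP pG x xG) (min_belief_subset _ _ (strict_core_sup pG)).
Qed.

Lemma strictly_evident_lt C p q E : p < q -> q <= 1 ->
  p_evident_indicating S C q E -> strictly_evident C p E.
Proof.
move=> pq q1 qE; apply/forall_inP => x xE; apply: lt_le_trans pq _.
by apply/le_min_beliefP => // i; apply: qE.
Qed.

Lemma strictly_evidentW C p E : p <= 1 ->
  strictly_evident C p E -> p_evident_indicating S C p E.
Proof.
move=> p1 /forall_inP pE x i /pE /ltW pm.
exact: (le_min_beliefP C E x p1 pm).
Qed.

(** * Executions of the algorithm *)

Lemma super_p_evident_stepP C p F :
  strictly_evident C p F \/ exists F', super_p_evident_step S C p F F'.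
Proof.
have [sF|] := boolP (strictly_evident C p F); first by left.
case/forall_inPn => x xF; rewrite -leNgt => lex.
by right; exists (F :\ x), x.
Qed.

(** The inclusion of the core in [F] is invariant: a state of the core has minimal belief above [p]
    in the core, hence in [F], and is never removed. Each removal shrinks [F], and once none is
    possible [F] is strictly evident, so it equals the core. *)
Lemma always_returns_super C i w v E p F :
  strict_core C p \subset F ->
  always_returns S C i w v (AtTest R E (strict_core C p)) ->
  always_returns S C i w v (InSuper E p F).
Proof.
move=> cF ret; have [n] := ubnP #|F|; elim: n F cF => // n IHn F cF ltn.
apply: always_returns_later.
  case: (super_p_evident_stepP C p F) => [sF|[F' stepF]].
    exists (AtTest R E F); apply: step_super_return => F' [x [xF lex _]].
    by have := forall_inP sF x xF; rewrite ltNge lex.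
  by exists (InSuper E p F'); apply: step_remove.
move=> s' st; inversion st as [| |E0 p0 F0 F' stF|E0 p0 F0 nst]; subst.
  case: stF => x [xF lex ->]; apply: IHn.
    rewrite subsetD1 cF; apply/negP => xc.
    have := forall_inP (strict_coreP C p) x xc; rewrite ltNge.
    by rewrite (le_trans (min_belief_subset _ _ cF) lex).
  by rewrite (cardsD1 x) xF in ltn.
case: (super_p_evident_stepP C p F) => [sF|[F' /nst //]].
suff -> : F = strict_core C p by [].
by apply/eqP; rewrite eqEsubset cF strict_core_sup.
Qed.

(** Induction on the size of [F], which shrinks to its strict core in each pass. [E] is arbitrary
    because positive belief in [F] forces a pass, which overwrites [E]. *)
Lemma always_returns_loop C i w E F :
  0 < belief S i F w ->
  largest_p_evident_indicating S C (evidence_level S F C) F ->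
  exists G,
    [/\ 0 < belief S i G w,
        largest_p_evident_indicating S C (evidence_level S G C) G,
        ~~ (0 < belief S i (strict_core C (evidence_level S G C)) w)
      & always_returns S C i w (evidence_level S G C) (AtTest R E F)].
Proof.
have [n] := ubnP #|F|; elim: n E F => // n IHn E F ltn bF Fmax.
set p := evidence_level S F C; set F' := strict_core C p.
have F'F : F' \subset F.
  by apply: Fmax.2; apply: strictly_evidentW (strict_coreP C p); apply: evidence_level_le1.
(* A state attaining the minimum cannot survive: its minimal belief in [F'] is at most [p]. *)
have [x xF xp] : exists2 x, x \in F & min_belief S F C x = p.
  by have [y yF _] := belief_gt0_meets bF; apply: evidence_level_attained yF.
have xF' : x \notin F'.
  apply/negP => /(forall_inP (strict_coreP C p)); apply/negP.
  by rewrite -leNgt -[leRHS]xp min_belief_subset.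
have ltF' : (#|F'| < #|F|)%N.
  by apply: proper_card; apply/properP; split=> //; exists x.
have retE E0 v : always_returns S C i w v (AtTest R F F') ->
    always_returns S C i w v (AtTest R E0 F).
  move=> ret; apply: always_returns_later.
    by exists (InSuper F p F); apply: step_enter.
  move=> s' st; inversion st as [E1 F1 _|E1 F1 nbF| |]; subst; last by [].
  exact: always_returns_super.
have [bF'|nbF'] := boolP (0 < belief S i F' w); last first.
  (* The next test fails with [E] already set to [F]. *)
  exists F; split=> //; apply: retE; apply: always_returns_later.
    by exists (Returned Omega p); apply: step_exit; apply/negP.
  move=> s' st; inversion st as [E1 F1 bF1|E1 F1 _| |]; subst.
    by case/negP: nbF'.
  exact: always_returns_now.
have [||G [? ? ? retG]] := IHn F F' _ bF'; first exact: leq_trans ltF' _.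
  split; first by apply/le_evidence_levelP; rewrite ?evidence_level_le1.
  (* The level of [F'] is attained at one of its states, so it exceeds [p], and an event evident at
     that level is strictly evident at [p]. *)
  move=> G Gev; apply: strict_core_sup.
  apply: strictly_evident_lt (evidence_level_le1 F' C) Gev.
  have [y yF' _] := belief_gt0_meets bF'.
  have [z zF' <-] := evidence_level_attained C yF'.
  exact: (forall_inP (strict_coreP C p)).
by exists G; split=> //; apply: retE.
Qed.

(** * Maximally evident events *)

(** Conversely [E] serves as its own [F]: a superset of higher level would lie in [E] by maximality,
    hence equal [E]. *)
Lemma max_evidentP C E :
  max_evident S C E <->
  largest_p_evident_indicating S C (evidence_level S E C) E.
Proof.
split=> [[F [_ [p [/is_evidence_levelE -> //]]]]|Emax].
exists E; split=> //; exists (evidence_level S E C); split=> //.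
  exact: evidence_levelP.
move=> G q EG [/andP[_ q1] qG _]; rewrite leNgt; apply/negP => ltq.
have GE : G \subset E.
  apply: Emax.2; apply: strictly_evidentW (evidence_level_le1 E C) _.
  exact: strictly_evident_lt ltq q1 qG.
have eqEG : G = E by apply/eqP; rewrite eqEsubset GE.
move: ltq; rewrite ltNge; apply/negP; rewrite negbK.
by rewrite -eqEG; apply/le_evidence_levelP.
Qed.

(* Above level 0, an event contains a state of the cell of w exactly when its
   belief at w is positive, so the loop test detects the meeting even if some
   states have measure 0. *)
Lemma meets_strict_core_gt0 C p i w w' : 0 <= p ->
  w' \in strict_core C p -> w' \in cell S i w ->
  0 < belief S i (strict_core C p) w.
Proof.
move=> p0 w'K /belief_cell <-; apply: le_lt_trans p0 _.
exact: lt_le_trans (forall_inP (strict_coreP C p) _ w'K) (min_belief_le _ _ _ _).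
Qed.

(** A maximally evident event of higher level meeting the cell would lie in the strict core and give
    it positive belief. Two candidates of equal level are both largest at that level, so they
    coincide. *)
Lemma highest_max_evident_unique C i w E :
  0 < belief S i E w ->
  largest_p_evident_indicating S C (evidence_level S E C) E ->
  ~~ (0 < belief S i (strict_core C (evidence_level S E C)) w) ->
  unique (highest_max_evident_meeting S C i w) E.
Proof.
move=> bE Emax nbK.
have Emeet : max_evident_meeting S C i w E.
  by split; [apply/max_evidentP | apply: belief_gt0_meets].
have Ehigh G : max_evident_meeting S C i w G ->
    evidence_level S G C <= evidence_level S E C.
  move=> [/max_evidentP[Gev _] [w' w'G w'C]]; rewrite leNgt; apply: contra nbK => ltEG.
  apply: meets_strict_core_gt0 (evidence_level_ge0 E C) _ w'C.
  apply: (subsetP (strict_core_sup _)) w'G.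
  exact: strictly_evident_lt ltEG (evidence_level_le1 G C) Gev.
split; first split=> // G p q Gmeet /is_evidence_levelE -> /is_evidence_levelE ->.
  exact: Ehigh.
move=> G [Gmeet Ghigh].
have eqEG : evidence_level S E C = evidence_level S G C.
  apply/le_anti; rewrite Ehigh // andbT.
  exact: Ghigh Emeet (evidence_levelP C G) (evidence_levelP C E).
have [/max_evidentP Gmax _] := Gmeet.
move: Gmax; rewrite -eqEG => Gmax.
by apply/eqP; rewrite eqEsubset Gmax.2 ?Emax.2 //; [apply: Gmax.1 | apply: Emax.1].
Qed.

End CommonBelief.

Theorem proposition2 (R : realType) (Omega : finType)
    (S : info_structure R Omega) (C : {set Omega}) (i : 'I_2) (w : Omega) :
  exists (E : {set Omega}) (v : R),
    [/\ unique (highest_max_evident_meeting S C i w) E,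
        common_p_belief_returns S C i w v
      & is_evidence_level S C E v].
Proof.
(* The initial [F] contains every event, so it starts the chain. *)
have Tmax : largest_p_evident_indicating S C (evidence_level S setT C) setT.
  by split=> [|G _]; [case: (evidence_levelP S C setT) | apply: subsetT].
have [E [bE Emax nbK ret]] := always_returns_loop setT (belief_setT S i w) Tmax.
exists E, (evidence_level S E C); split=> //.
  exact: highest_max_evident_unique.
exact: evidence_levelP.
Qed.
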